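(* Let $f(z)$ be an entire function of genus $0$ such that $f(0)=1$. Then $f$ has only positive roots (every root of $f$ is a positive real number) if and only if there is some positive number $\rho$ with $0<\rho\le\inf\{|z| : f(z)=0\}$ such that for all nonnegative integers $j,k$ $$\frac{\partial^{j+k}}{\partial z^{j+k}}\left\{(z-1)^j\,\frac{f'(\rho z)}{f(\rho z)}\right\}\bigg|_{z=0}\le 0 .$$
   Context: Genus: for an entire function of finite order written as $f(z)=z^m e^{p(z)}\prod_{n}\left(1-\frac{z}{z_n}\right)\exp\left(\frac{z}{z_n}+\dots+\frac1k\left(\frac{z}{z_n}\right)^k\right)$, where $\{z_n\}$ are the nonzero roots of $f$ (repeated according to multiplicity), $p$ is a polynomial of degree $j$, and $k$ is the smallest nonnegative integer with $\sum_n |z_n|^{-(k+1)}<\infty$, the genus is $\max\{j,k\}$. Here $f'(\rho z)$ denotes the derivative $f'$ evaluated at $\rho z$. For a complex number $c$, $c\le0$ means that $c$ is real and $\le 0$. If $f$ has no zeros, the infimum is $+\infty$. *)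

(* Defs.v *)
From HB Require Import structures.
From mathcomp Require Import all_boot all_order all_algebra complex.
From mathcomp Require Import all_classical all_reals all_analysis.

Set Implicit Arguments.
Unset Strict Implicit.
Unset Printing Implicit Defensive.

Import Order.TTheory GRing.Theory Num.Theory numFieldNormedType.Exports.
Import ComplexField.Normc.

Local Open Scope classical_set_scope.
Local Open Scope card_scope.
Local Open Scope complex_scope.
Local Open Scope ring_scope.

(* R[i] as a normed space over itself, so that derivatives of functions
   R[i] -> R[i] are complex derivatives. *)
#[non_forgetful_inheritance]
HB.instance Definition _ (R : rcfType) := GRing.ComAlgebra.copy R[i] R[i]^o.
#[non_forgetful_inheritance]
HB.instance Definition _ (R : rcfType) := Vector.copy R[i] R[i]^o.
#[non_forgetful_inheritance]
HB.instance Definition _ (R : rcfType) := NormedModule.copy R[i] R[i]^o.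

Definition cexp (R : realType) (z : R[i]) : R[i] :=
  (expR (complex.Re z) * cos (complex.Im z)) +i*
  (expR (complex.Re z) * sin (complex.Im z)).

Definition entire (R : realType) (f : R[i] -> R[i]) : Prop :=
  forall z, derivable f z 1.

Definition finite_order (R : realType) (f : R[i] -> R[i]) : Prop :=
  exists a r : R, forall z,
    r <= normc z -> normc (f z) <= expR (normc z `^ a).

(* d = 0 when w is not a root of f. *)
Definition root_multiplicity (R : realType) (f : R[i] -> R[i]) (w : R[i])
    (d : nat) : Prop :=
  exists g : R[i] -> R[i],
    [/\ entire g, g w != 0 & forall z, f z = (z - w) ^+ d * g z].

(* The family (a n), indexed by the finite or infinite set of the n with D n,
   lists the nonzero roots of f, each as often as its multiplicity. *)
Definition enumerates_nonzero_roots (R : realType) (f : R[i] -> R[i])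
    (D : pred nat) (a : nat -> R[i]) : Prop :=
  (forall n, D n -> a n != 0) /\
  forall w, w != 0 ->
    exists d, root_multiplicity f w d /\ [set n | D n /\ a n = w] #= `I_d.

Definition summable_inverse_powers (R : realType) (D : pred nat)
    (a : nat -> R[i]) (k : nat) : Prop :=
  (\sum_(0 <= n <oo | D n) (normc (a n) ^- k.+1)%:E < +oo)%E.

Definition primary_factor (R : realType) (k : nat) (u : R[i]) : R[i] :=
  (1 - u) * cexp (\sum_(1 <= i < k.+1) i%:R^-1 * u ^+ i).

(* The degree of the polynomial p is (size p).-1, which is 0 for p = 0. *)
Definition has_genus (R : realType) (f : R[i] -> R[i]) (g : nat) : Prop :=
  [/\ entire f, finite_order f &
    exists (m : nat) (p : {poly R[i]}) (D : pred nat) (a : nat -> R[i])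
      (k : nat),
    [/\ enumerates_nonzero_roots f D a,
        summable_inverse_powers D a k,
        forall k', summable_inverse_powers D a k' -> (k <= k')%N,
        forall z : R[i],
          z ^+ m * cexp p.[z] *
            \prod_(0 <= n < N | D n) primary_factor k (z / a n)
          @[N --> \oo] --> f z &
        g = maxn (size p).-1 k]].

(* Main.v *)
Require Import Defs.
From mathcomp Require Import all_boot all_order all_algebra complex.
From mathcomp Require Import all_classical all_reals all_analysis.
From mathcomp Require Import ring lra.

Set Implicit Arguments.
Unset Strict Implicit.
Unset Printing Implicit Defensive.

Import Order.TTheory GRing.Theory Num.Theory numFieldNormedType.Exports.
Import ComplexField.Normc.

Local Open Scope classical_set_scope.
Local Open Scope complex_scope.
Local Open Scope ring_scope.

(** Genus [0] and [f 0 = 1] mean that [f z] is the product of the factors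
    [1 - z * b n], where the [b n] are the inverses of the roots, padded with zeros,
    and are absolutely summable.  If [rho * |b n| <= 1] for all [n], put
    [t n = rho * b n].  On the open unit disc the logarithmic derivative
    [f'(rho z) / f(rho z)] is then minus the sum of the [b n / (1 - t n * z)], and
    its [m]-th Taylor coefficient at [0] is minus the sum of the
    [b n * t n ^+ m].  Multiplying by [z - 1] replaces a coefficient sequence by
    its backward differences, so (lemma [log_derivative_moments]) the derivative
    in the theorem is
    [- (j + k)! * sum_n b n * t n ^+ k * (1 - t n) ^+ j].

    If the roots are positive, then for [rho] small the [t n] lie in [0, 1] and
    every term of that sum is nonnegative.

    For the converse, let [L p] be the sum of the [b n * p.[t n]], a linear form
    on polynomials.  The hypothesis says that [L] is nonnegative on the
    products [x ^ k * (1 - x) ^ j], as in the Hausdorff moment problem; hence on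
    the cone that they generate, which is closed under products.  Suppose that
    some [w = t n0] is not in [0, 1].  There is a polynomial [q] such that [q] and
    [1 - q] are in the cone, [|q w| > 1], and [|q| <= 1] near [0] (lemma
    [cone_separation_near0]).  Let [p0] vanish at those of the finitely many
    [t n] outside a neighbourhood of [0] that differ from [w].  Since [q] and
    [1 - q] are in the cone, [L (q ^+ N * p0)] is bounded in [N]
    (lemma [moment_exp_bounded]).  But the nodes near [0] contribute a bounded
    amount to it, and the nodes equal to [w] contribute a nonzero multiple of
    [q.[w] ^+ N], which is unbounded.  So all the [t n] are nonnegative (lemma
    [moment_nodes_ge0]).  Powers of [q] thus take the place of a representing
    measure and of analytic continuation. *)

(** * Norm and convergence of complex sequences *)

Lemma normcE_norm (R : realType) (z : R[i]) : `|z| = (normc z)%:C.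
Proof. reflexivity. Qed.

Lemma normc_ge0 (R : realType) (z : R[i]) : 0 <= normc z.
Proof. by rewrite -lecR -normcE_norm; exact: normr_ge0. Qed.

Lemma normc_triangle (R : realType) (x y : R[i]) :
  normc (x + y) <= normc x + normc y.
Proof. exact: le_normcD. Qed.

Lemma normc_opp (R : realType) (x : R[i]) : normc (- x) = normc x.
Proof. exact: normcN. Qed.

Lemma normcX (R : realType) (x : R[i]) n : normc (x ^+ n) = normc x ^+ n.
Proof. by elim: n => [|n IH]; rewrite ?normc1 // !exprS normcM IH. Qed.

Lemma normc_real (R : realType) (r : R) : normc r%:C = `|r|.
Proof. by rewrite /normc /= expr0n addr0 sqrtr_sqr. Qed.

Lemma normc_nat (R : realType) n : normc (n%:R : R[i]) = n%:R.
Proof. by rewrite -(rmorph_nat (real_complex R)) normc_real normr_nat. Qed.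

Lemma normc_gt0 (R : realType) (z : R[i]) : (0 < normc z) = (z != 0).
Proof. rewrite -ltcR -normcE_norm; exact: normr_gt0. Qed.

Lemma normc_sum (R : realType) (I : Type) (r : seq I) (F : I -> R[i]) :
  normc (\sum_(i <- r) F i) <= \sum_(i <- r) normc (F i).
Proof.
elim: r => [|i r IH]; first by rewrite !big_nil normc0.
by rewrite !big_cons (le_trans (normc_triangle _ _)) // lerD2l.
Qed.

Lemma Re_le_normc (R : realType) (z : R[i]) : `|complex.Re z| <= normc z.
Proof. by rewrite -lecR; exact: normc_ge_Re. Qed.

Lemma Im_le_normc (R : realType) (z : R[i]) : `|complex.Im z| <= normc z.
Proof.
case: z => x y; rewrite /normc /= -sqrtr_sqr ler_wsqrtr //.
by rewrite lerDr sqr_ge0.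
Qed.

Lemma normc_le_ReIm (R : realType) (z : R[i]) :
  normc z <= `|complex.Re z| + `|complex.Im z|.
Proof.
case: z => x y; rewrite /normc /= -[leRHS]ger0_norm ?addr_ge0 //.
rewrite -(sqrtr_sqr (`|x| + `|y|)).
rewrite ler_wsqrtr // sqrrD !real_normK ?num_real // addrAC lerDl.
by rewrite mulrn_wge0 // mulr_ge0.
Qed.

(** Neighbourhoods in [R[i]] are indexed by the radii that are positive in
    the partial order of [R[i]]; this moves convergence to the real line, where
    linear arithmetic is available. *)
Lemma cvg_normcP (R : realType) (u : nat -> R[i]) (l : R[i]) :
  u n @[n --> \oo] --> l <-> normc (l - u n) @[n --> \oo] --> (0 : R).
Proof.
split=> [/cvgrPdist_le H|/cvgrPdist_le H].
  apply/cvgrPdist_le => e e0.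
  have : 0 < e%:C :> R[i] by rewrite ltcR.
  move=> /H; apply: filterS => n.
  by rewrite normcE_norm lecR sub0r normrN (ger0_norm (normc_ge0 _)).
apply/cvgrPdist_le => e e0.
have e0' : 0 < complex.Re e by move: e0; rewrite ltcE => /andP[].
have eE : e = (complex.Re e)%:C by rewrite RRe_real // gtr0_real.
move/H: e0'; apply: filterS => n.
by rewrite eE normcE_norm lecR sub0r normrN (ger0_norm (normc_ge0 _)).
Qed.

Lemma cvg_Re (R : realType) (u : nat -> R[i]) (l : R[i]) :
  u n @[n --> \oo] --> l ->
  complex.Re (u n) @[n --> \oo] --> complex.Re l.
Proof.
move=> /cvg_normcP /cvgrPdist_le H; apply/cvgrPdist_le => e /H.
apply: filterS => n; rewrite sub0r normrN (ger0_norm (normc_ge0 _)).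
apply: le_trans; rewrite (_ : _ - _ = complex.Re (l - u n)) ?Re_le_normc //.
by move: (u n) => [? ?]; move: (l) => [? ?].
Qed.

Lemma cvg_Im (R : realType) (u : nat -> R[i]) (l : R[i]) :
  u n @[n --> \oo] --> l ->
  complex.Im (u n) @[n --> \oo] --> complex.Im l.
Proof.
move=> /cvg_normcP /cvgrPdist_le H; apply/cvgrPdist_le => e /H.
apply: filterS => n; rewrite sub0r normrN (ger0_norm (normc_ge0 _)).
apply: le_trans; rewrite (_ : _ - _ = complex.Im (l - u n)) ?Im_le_normc //.
by move: (u n) => [? ?]; move: (l) => [? ?].
Qed.

Lemma cvg_ReIm (R : realType) (u : nat -> R[i]) (x y : R) :
  complex.Re (u n) @[n --> \oo] --> x -> complex.Im (u n) @[n --> \oo] --> y ->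
  u n @[n --> \oo] --> x +i* y.
Proof.
move=> hx hy; apply/cvg_normcP.
apply: (@squeeze_cvgr _ _ _ _ (cst 0)
  (fun n => `|x - complex.Re (u n)| + `|y - complex.Im (u n)|)).
- apply: nearW => n; rewrite normc_ge0 /=.
  by apply: le_trans (normc_le_ReIm _) _; case: (u n).
- exact: cvg_cst.
- rewrite -[X in _ --> X](addr0 0).
  by apply: cvgD; apply/norm_cvg0P; apply/cvgr0Pnorm_le => e e0;
    [move/cvgrPdist_le: hx|move/cvgrPdist_le: hy]; apply.
Qed.

Lemma cvg_normc (R : realType) (u : nat -> R[i]) (l : R[i]) :
  u n @[n --> \oo] --> l -> normc (u n) @[n --> \oo] --> normc l.
Proof.
move=> /cvg_normcP /cvgrPdist_le H; apply/cvgrPdist_le => e /H.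
apply: filterS => n; rewrite sub0r normrN (ger0_norm (normc_ge0 _)).
apply: le_trans; rewrite ler_distl.
have := normc_triangle (l - u n) (u n); have := normc_triangle (- (l - u n)) l.
rewrite normc_opp opprB !subrK; lra.
Qed.

Lemma cvg_ge0c (R : realType) (u : nat -> R[i]) (l : R[i]) :
  (forall n, 0 <= u n) -> u n @[n --> \oo] --> l -> 0 <= l.
Proof.
move=> u0 ul; rewrite lecE /=; apply/andP; split.
  apply/eqP; apply: (@cvg_unique R _ _ _ _ _ (cvg_Im ul)) => //.
  rewrite (_ : (fun n => complex.Im (u n)) = cst 0); first exact: cvg_cst.
  by apply/funext => n; exact: ger0_Im.
apply: (@closed_cvg _ _ _ _ _ (fun x : R => 0 <= x) _ _ _ (cvg_Re ul)).
- exact: closed_ge.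
- by apply: nearW => n; move: (u0 n); rewrite lecE => /andP[].
Qed.

Lemma cvg_normc_le (R : realType) (u : nat -> R[i]) (l : R[i]) (K : R) :
  u n @[n --> \oo] --> l -> (\forall n \near \oo, normc (u n) <= K) ->
  normc l <= K.
Proof.
move=> /cvg_normc ul uK.
exact: (@closed_cvg _ _ _ _ _ (fun x : R => x <= K) _ _ _ ul).
Qed.

(** * Absolutely summable complex series *)

Definition abs_summable (R : realType) (u : nat -> R[i]) : Prop :=
  exists S : R, forall N, \sum_(0 <= n < N) normc (u n) <= S.

Definition csum (R : realType) (u : nat -> R[i]) : R[i] :=
  limn (fun N => \sum_(0 <= n < N) u n).

Lemma abs_summable_le (R : realType) (u v : nat -> R[i]) (K : R) :
  abs_summable u -> (forall n, normc (v n) <= K * normc (u n)) ->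
  abs_summable v.
Proof.
move=> [S uS] vu; exists (`|K| * S) => N.
apply: le_trans (ler_wpM2l (normr_ge0 K) (uS N)).
rewrite mulr_sumr; apply: ler_sum => n _; apply: le_trans (vu n) _.
by apply: ler_wpM2r; rewrite ?normc_ge0 ?ler_norm.
Qed.

Lemma bounded_abs_series_cvg (R : realType) (x : nat -> R) (S : R) :
  (forall N, \sum_(0 <= n < N) `|x n| <= S) -> cvgn (series x).
Proof.
move=> xS; apply: normed_cvg; apply: nondecreasing_is_cvgn.
  by apply: nondecreasing_series => n _ _; exact: normr_ge0.
by exists S => _ [N _ <-]; exact: xS.
Qed.

(** Absolute convergence of a series is reduced to that of its real and
    imaginary parts, each of which is dominated by the norm. *)
Lemma csum_cvg (R : realType) (u : nat -> R[i]) : abs_summable u ->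
  (\sum_(0 <= n < N) u n) @[N --> \oo] --> csum u.
Proof.
move=> [S uS].
have hR : cvgn (series (fun n => complex.Re (u n))).
  apply: (@bounded_abs_series_cvg _ _ S) => N; apply: le_trans (uS N).
  by apply: ler_sum => n _; exact: Re_le_normc.
have hI : cvgn (series (fun n => complex.Im (u n))).
  apply: (@bounded_abs_series_cvg _ _ S) => N; apply: le_trans (uS N).
  by apply: ler_sum => n _; exact: Im_le_normc.
have H : (fun N => \sum_(0 <= n < N) u n) @ \oo -->
   limn (series (fun n => complex.Re (u n))) +i*
   limn (series (fun n => complex.Im (u n))).
  apply: cvg_ReIm.
  - rewrite (_ : (fun n => complex.Re _) = series (fun n => complex.Re (u n))) //.
    apply/funext => N; rewrite seriesEnat /=.
    elim: N => [|N IH]; first by rewrite !big_geq.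
    by rewrite !big_nat_recr //= -IH; case: (\sum_(_ <= _ < _) _) (u N) => [? ?] [].
  - rewrite (_ : (fun n => complex.Im _) = series (fun n => complex.Im (u n))) //.
    apply/funext => N; rewrite seriesEnat /=.
    elim: N => [|N IH]; first by rewrite !big_geq.
    by rewrite !big_nat_recr //= -IH; case: (\sum_(_ <= _ < _) _) (u N) => [? ?] [].
by apply: cvgP H.
Qed.

Lemma csum_unique (R : realType) (u : nat -> R[i]) l :
  (\sum_(0 <= n < N) u n) @[N --> \oo] --> l -> csum u = l.
Proof. by move=> H; apply: cvg_lim. Qed.

Lemma csumD (R : realType) (u v : nat -> R[i]) :
  abs_summable u -> abs_summable v ->
  csum (fun n => u n + v n) = csum u + csum v.
Proof.
move=> hu hv; apply: csum_unique.
under eq_cvg do rewrite big_split /=.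
by apply: cvgD; exact: csum_cvg.
Qed.

Lemma csumZ (R : realType) (u : nat -> R[i]) c :
  abs_summable u -> csum (fun n => c * u n) = c * csum u.
Proof.
move=> hu; apply: csum_unique.
under eq_cvg do rewrite -mulr_sumr.
by apply: cvgMr; exact: csum_cvg.
Qed.

Lemma csum_ge0 (R : realType) (u : nat -> R[i]) :
  abs_summable u -> (forall n, 0 <= u n) -> 0 <= csum u.
Proof.
move=> hu u0; apply: cvg_ge0c (csum_cvg hu) => N.
by apply: sumr_ge0.
Qed.

(** * Termwise differentiation *)

(** A quadratic bound on the error of the linear approximation is all that is
    ever checked below: unlike the definition of the derivative, it passes to
    limits of partial sums and products. *)
Lemma is_derive_quadratic (R : realType) (f : R[i] -> R[i]) (z d : R[i])
    (K e : R) : 0 < e ->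
  (forall h, normc h < e ->
     normc (f (z + h) - f z - h * d) <= K * normc h ^+ 2) ->
  is_derive z 1 f d.
Proof.
move=> e0 H.
have K0 : 0 <= `|K| + 1 by rewrite addr_ge0.
have fd : (fun h : R[i] => h^-1 *: (f (h *: (1 : R[i]) + z) - f z)) @ 0^' --> d.
  apply/cvgrPdist_le => r r0.
  have r0' : 0 < complex.Re r by move: r0; rewrite ltcE => /andP[].
  have rE : r = (complex.Re r)%:C by rewrite RRe_real // gtr0_real.
  (* The quotient is within (`|K| + 1) * normc h of d; the 1 avoids dividing by 0. *)
  pose s := Num.min e (complex.Re r / (`|K| + 1)).
  have s0 : 0 < s by rewrite lt_min e0 divr_gt0 // ltr_wpDl.
  have s0c : 0 < s%:C :> R[i] by rewrite ltcR.
  rewrite near_withinE; near=> h.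
  move=> hn0.
  have hs : normc h < s.
    rewrite -ltcR -normcE_norm; near: h.
    by exists s%:C => //= y /=; rewrite sub0r normrN.
  have hn0' : 0 < normc h by rewrite normc_gt0.
  move: hs; rewrite lt_min => /andP[he hr].
  have := H h he.
  rewrite rE normcE_norm lecR /= => Hh.
  have -> : d - h^-1 *: (f (h *: (1 : R[i]) + z) - f z) =
            - (h^-1 * (f (z + h) - f z - h * d)).
    rewrite (_ : h *: 1 = h) ?(addrC h z); last exact: mulr1.
    have -> : h^-1 *: (f (z + h) - f z) = h^-1 * (f (z + h) - f z) by [].
    by field.
  rewrite normc_opp normcM normcV mulrC ler_pdivrMr //.
  apply: le_trans Hh _; rewrite expr2 mulrA ler_wpM2r ?normc_ge0 //.
  apply: (@le_trans _ _ ((`|K| + 1) * normc h)).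
    by rewrite ler_wpM2r ?normc_ge0 //; have := ler_norm K; lra.
  by rewrite mulrC -ler_pdivlMr ?ltW // ltr_wpDl.
have dv : derivable f z 1 by apply/cvg_ex; exists d.
by apply: (DeriveDef dv); exact: cvg_lim fd.
Unshelve. all: by end_near.
Qed.

Lemma is_derive_csum (R : realType) (phi : nat -> R[i] -> R[i])
    (phi' u : nat -> R[i]) (z : R[i]) (K e : R) :
  0 < e -> abs_summable u ->
  abs_summable phi' ->
  (forall y, normc (y - z) < e -> abs_summable (phi^~ y)) ->
  (forall n h, normc h < e ->
     normc (phi n (z + h) - phi n z - h * phi' n)
       <= K * normc (u n) * normc h ^+ 2) ->
  is_derive z 1 (fun y => csum (phi^~ y)) (csum phi').
Proof.
move=> e0 [S uS] phi's phis H.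
apply: (@is_derive_quadratic _ _ _ _ (`|K| * S) e e0) => h he.
have s1 : abs_summable (phi^~ (z + h)) by apply: phis; rewrite addrC addKr.
have s2 : abs_summable (phi^~ z) by apply: phis; rewrite subrr normc0.
have cv : (\sum_(0 <= n < N) (phi n (z + h) - phi n z - h * phi' n))
     @[N --> \oo] -->
   csum (phi^~ (z + h)) - csum (phi^~ z) - h * csum phi'.
  under eq_cvg do rewrite !big_split /= !sumrN -mulr_sumr.
  apply: cvgB; first by apply: cvgB; exact: csum_cvg.
  by apply: cvgMr; exact: csum_cvg.
apply: cvg_normc_le cv _; apply: nearW => N.
apply: le_trans (normc_sum _ _) _.
apply: (@le_trans _ _ (\sum_(0 <= n < N) `|K| * normc h ^+ 2 * normc (u n))).
  apply: ler_sum => n _; apply: le_trans (H n h he) _.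
  rewrite mulrAC ler_wpM2r ?normc_ge0 // ler_wpM2r ?ler_norm //.
  by rewrite exprn_ge0 // normc_ge0.
rewrite -mulr_sumr [leRHS]mulrAC ler_wpM2l //.
by rewrite mulr_ge0 // exprn_ge0 // normc_ge0.
Qed.

(** The resolvents [x = 1 / (1 - t * z)] and [y = 1 / (1 - t * (z + h))] satisfy
    [y - x = h * t * x * y], which gives the bound for [p + 1] from the one for
    [p].  The constant does not depend on [t], so the bound can be summed over
    all nodes. *)
Lemma resolvent_pow_taylor (R : realType) (k : R) (p : nat) : 0 <= k ->
  exists2 K : R, 0 <= K & forall t z h x y : R[i],
    normc t <= 1 -> normc x <= k -> normc y <= k ->
    (1 - t * z) * x = 1 -> (1 - t * (z + h)) * y = 1 ->
    normc (y ^+ p - x ^+ p - h * (p%:R * t * x ^+ p.+1)) <= K * normc h ^+ 2.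
Proof.
move=> k0; elim: p => [|p [K K0 IH]].
  by exists 0 => // t z h x y *; rewrite !expr0 subrr !mul0r mulr0 subr0 normc0.
exists (k * K + p.+1%:R * k ^+ p.+3).
  by rewrite addr_ge0 // mulr_ge0 // exprn_ge0.
move=> t z h x y t1 xk yk hx hy.
have yx : y - x = h * t * x * y.
  have -> : h * t * x * y =
    y * ((1 - t * z) * x) - x * ((1 - t * (z + h)) * y) by ring.
  by rewrite hx hy !mulr1.
have -> : y ^+ p.+1 - x ^+ p.+1 - h * (p.+1%:R * t * x ^+ p.+2) =
   y * (y ^+ p - x ^+ p - h * (p%:R * t * x ^+ p.+1))
   + p.+1%:R * t ^+ 2 * (x ^+ p.+2 * y) * h ^+ 2.
  have yE : y = x + h * t * x * y by rewrite -yx; ring.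
  rewrite !exprS -natr1.
  transitivity (y * (y ^+ p - x ^+ p - h * (p%:R * t * (x * x ^+ p)))
    + x ^+ p * (y - x) + p%:R * h * t * (x * x ^+ p) * (y - x) 
    + h * t * (x * x ^+ p) * (- x)); first by ring.
  rewrite {1}yx.
  transitivity (y * (y ^+ p - x ^+ p - h * (p%:R * t * (x * x ^+ p)))
    + x ^+ p * (h * t * x * (y - x)) + p%:R * h * t * (x * x ^+ p) * (y - x)).
    by ring.
  by rewrite yx expr0; ring.
apply: le_trans (normc_triangle _ _) _; rewrite mulrDl; apply: lerD.
  rewrite normcM -[leRHS]mulrA; apply: ler_pM; rewrite ?normc_ge0 //.
  exact: (IH t z h x y t1 xk yk hx hy).
rewrite normcM normcX ler_wpM2r ?exprn_ge0 ?normc_ge0 //.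
rewrite normcM (normcM _%:R) (normcM _ y) normc_nat !normcX.
rewrite -[leLHS]mulrA ler_wpM2l //.
rewrite -[leRHS]mul1r; apply: ler_pM.
- by rewrite exprn_ge0 // normc_ge0.
- by rewrite mulr_ge0 ?exprn_ge0 ?normc_ge0.
- by rewrite exprn_ile1 // normc_ge0.
- rewrite [leRHS]exprSr; apply: ler_pM; rewrite ?exprn_ge0 ?normc_ge0 //.
  by rewrite lerXn2r ?nnegrE ?normc_ge0.
Qed.

(** * Derivatives of sums of resolvents *)

Lemma normc_resolvent_le (R : realType) (t z : R[i]) : normc t <= 1 ->
  normc z < 1 -> 1 - t * z != 0 /\ normc ((1 - t * z)^-1) <= (1 - normc z)^-1.
Proof.
move=> t1 z1.
have H : 1 - normc z <= normc (1 - t * z).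
  have := normc_triangle (1 - t * z) (t * z); rewrite subrK normc1 normcM.
  have : normc t * normc z <= normc z by rewrite ler_piMl ?normc_ge0.
  lra.
have H0 : 0 < normc (1 - t * z) by apply: lt_le_trans H; rewrite subr_gt0.
split; first by rewrite -normc_gt0.
by rewrite normcV lef_pV2 // posrE subr_gt0.
Qed.

(** The [p]-th derivative of the sum of the [b n / (1 - t n * z)]. *)
Definition resolvent_series (R : realType) (b t : nat -> R[i]) (p : nat)
    (z : R[i]) : R[i] :=
  csum (fun n => p`!%:R * (b n * t n ^+ p * (1 - t n * z)^-1 ^+ p.+1)).

Lemma resolvent_summable (R : realType) (b t : nat -> R[i]) c p q z :
  abs_summable b -> (forall n, normc (t n) <= 1) -> normc z < 1 ->
  abs_summable (fun n => c * (b n * t n ^+ p * (1 - t n * z)^-1 ^+ q)).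
Proof.
move=> bs t1 z1.
apply: (@abs_summable_le _ _ _ (normc c * (1 - normc z)^-1 ^+ q) bs) => n.
have [_ H] := normc_resolvent_le (t1 n) z1.
rewrite normcM -[leRHS]mulrA ler_wpM2l ?normc_ge0 // normcM normcM !normcX.
rewrite mulrC; apply: ler_pM.
- by rewrite exprn_ge0 ?normc_ge0.
- by rewrite mulr_ge0 ?exprn_ge0 ?normc_ge0.
- by rewrite lerXn2r ?nnegrE ?normc_ge0 // invr_ge0 subr_ge0 ltW.
- by rewrite ler_piMr ?normc_ge0 // exprn_ile1 ?normc_ge0.
Qed.

Lemma is_derive_resolvent_series (R : realType) (b t : nat -> R[i]) p z :
  abs_summable b -> (forall n, normc (t n) <= 1) -> normc z < 1 ->
  is_derive z 1 (resolvent_series b t p) (resolvent_series b t p.+1 z).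
Proof.
move=> bs t1 z1.
(* For normc h < e, z and z + h stay at distance at least e from the unit circle,
   so both resolvents are bounded by e^-1. *)
pose e := (1 - normc z) / 2.
have e0 : 0 < e by rewrite divr_gt0 ?subr_gt0.
have [K K0 HK] := @resolvent_pow_taylor R e^-1 p.+1 (ltac:(by rewrite invr_ge0 ltW)).
apply: (@is_derive_csum _ _ _ b z (p`!%:R * K) e e0 bs).
- exact: resolvent_summable.
- move=> y yz; apply: resolvent_summable => //.
  have := normc_triangle (y - z) z; rewrite subrK; move: yz; rewrite /e; lra.
move=> n h he.
have zh : normc (z + h) <= 1 - e.
  by have := normc_triangle z h; move: he; rewrite /e; lra.
have zh1 : normc (z + h) < 1 by apply: le_lt_trans zh _; rewrite gtrBl.
have [hx0 hx] := normc_resolvent_le (t1 n) z1.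
have [hy0 hy] := normc_resolvent_le (t1 n) zh1.
have xk : normc (1 - t n * z)^-1 <= e^-1.
  apply: le_trans hx _; rewrite lef_pV2 ?posrE ?subr_gt0 //.
  by rewrite /e ler_pdivrMr //; have := normc_ge0 z; lra.
have yk : normc (1 - t n * (z + h))^-1 <= e^-1.
  by apply: le_trans hy _; rewrite lef_pV2 ?posrE ?subr_gt0 //; lra.
have H := HK (t n) z h _ _ (t1 n) xk yk (mulfV hx0) (mulfV hy0).
rewrite factS natrM (exprS (t n) p) /=.
set y := (1 - t n * (z + h))^-1 in H *; set x := (1 - t n * z)^-1 in H *.
have -> : p`!%:R * (b n * t n ^+ p * y ^+ p.+1) -
   p`!%:R * (b n * t n ^+ p * x ^+ p.+1) -
   h * (p.+1%:R * p`!%:R * (b n * (t n * t n ^+ p) * x ^+ p.+2)) =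
   (p`!%:R * (b n * t n ^+ p)) * (y ^+ p.+1 - x ^+ p.+1 -
     h * (p.+1%:R * t n * x ^+ p.+2)).
  by ring.
rewrite normcM normcM normc_nat (normcM (b n)) normcX.
rewrite -!mulrA ler_wpM2l // [leRHS]mulrCA ler_wpM2l ?normc_ge0 //.
rewrite -[leRHS]mul1r; apply: ler_pM; rewrite ?exprn_ge0 ?normc_ge0 //.
  by rewrite exprn_ile1 ?normc_ge0.
by move: H; rewrite -(mulrA p.+1%:R).
Qed.

(** Derivatives are only known on the open unit disc, so [G n] need not
    agree with the [n]-th derivative of [g] elsewhere. *)
Definition disc_derivatives (R : realType) (g : R[i] -> R[i])
    (G : nat -> R[i] -> R[i]) : Prop :=
  (forall z, normc z < 1 -> g z = G 0%N z) /\
  (forall n z, normc z < 1 -> is_derive z 1 (G n) (G n.+1 z)).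

Lemma near_unit_disc (R : realType) (z : R[i]) : normc z < 1 ->
  \forall y \near z, normc y < 1.
Proof.
move=> z1.
exists (1 - normc z)%:C; first by rewrite /= ltcR subr_gt0.
move=> y /=; rewrite normcE_norm ltcR => yz.
by have := normc_triangle (- (z - y)) z; rewrite normc_opp opprB subrK; lra.
Qed.

Lemma derive1n_disc (R : realType) (g : R[i] -> R[i]) G n z :
  disc_derivatives g G -> normc z < 1 -> g^`(n)%classic z = G n z.
Proof.
move=> [g0 GD]; elim: n z => [|n IH] z z1; first exact: g0.
rewrite derive1nS derive1E.
have nz : \forall y \near z, g^`(n)%classic y = G n y.
  by apply: filterS (near_unit_disc z1) => y; exact: IH.
by rewrite (near_eq_derive _ nz); have [] := GD n z z1.
Qed.

(** Leibniz rule; as [z - 1] has second derivative [0], only two terms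
    remain.  At [n = 0] the junk value [G 0.-1] is multiplied by [0]. *)
Lemma disc_derivatives_mul (R : realType) (g : R[i] -> R[i]) G :
  disc_derivatives g G ->
  disc_derivatives (fun z => (z - 1) * g z)
    (fun n z => (z - 1) * G n z + n%:R * G n.-1 z).
Proof.
move=> [g0 GD]; split=> [z z1|n z z1]; first by rewrite mul0r addr0 g0.
have D1 := GD n z z1.
have D2 : is_derive z (1 : R[i]) (fun y : R[i] => y - 1) 1.
  by rewrite -[X in is_derive _ _ _ X]subr0; exact: (@is_deriveB _ R[i] R[i] id (cst 1)).
have D3 : is_derive z (1 : R[i]) (fun y => n%:R * G n.-1 y) (n%:R * G n z).
  case: n {D1} => [|n].
    rewrite mul0r (_ : (fun y => _) = cst 0); first exact: is_derive_cst.
    by apply/funext => y; rewrite mul0r.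
  exact: is_deriveZ (GD n z z1).
have D4 := is_deriveD (is_deriveM D2 D1) D3.
apply: is_derive_eq D4 _.
transitivity ((z - 1) * G n.+1 z + G n z * 1 + n%:R * G n z) => //.
by rewrite -natr1 /=; ring.
Qed.

(** * Taylor coefficients and infinite products *)

Lemma moment_summable (R : realType) (b t : nat -> R[i]) j k :
  abs_summable b -> (forall n, normc (t n) <= 1) ->
  abs_summable (fun n => b n * t n ^+ k * (1 - t n) ^+ j).
Proof.
move=> bs t1; apply: (abs_summable_le (K := 2 ^+ j) bs) => n.
rewrite !normcM !normcX mulrC ler_pM ?mulr_ge0 ?exprn_ge0 ?normc_ge0 //.
  rewrite lerXn2r ?nnegrE ?normc_ge0 //.
  have := normc_triangle 1 (- t n); rewrite normc_opp normc1.
  by have := t1 n; lra.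
by rewrite ler_piMr ?normc_ge0 // exprn_ile1 ?normc_ge0.
Qed.

(** Multiplying [h] by [z - 1] turns the Taylor coefficients [c m] at [0] into
    [c (m - 1) - c m]; applied to [c m = sum_n b n * t n ^+ m], this produces one
    more factor [1 - t n] at each step of the induction on [j]. *)
Lemma moment_derivative (R : realType) (b t : nat -> R[i]) (h : R[i] -> R[i])
    j k :
  abs_summable b -> (forall n, normc (t n) <= 1) ->
  (forall z, normc z < 1 -> h z = csum (fun n => b n / (1 - t n * z))) ->
  (fun z => (z - 1) ^+ j * h z)^`(j + k)%classic 0 =
  (j + k)`!%:R * csum (fun n => b n * t n ^+ k * (1 - t n) ^+ j).
Proof.
move=> bs t1 hE.
suff [G GD G0] : exists2 G, disc_derivatives (fun z => (z - 1) ^+ j * h z) G &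
    forall k, G (j + k)%N 0 =
      (j + k)`!%:R * csum (fun n => b n * t n ^+ k * (1 - t n) ^+ j).
  by rewrite (derive1n_disc _ GD) ?normc0.
elim: j {k} => [|j [G GD G0]].
  exists (resolvent_series b t).
    split=> [z z1|n z z1]; last exact: is_derive_resolvent_series.
    rewrite expr0 mul1r hE //; congr csum; apply/funext => n.
    by rewrite fact0 mul1r expr0 mulr1 expr1.
  move=> k; rewrite add0n /resolvent_series -csumZ; last exact: moment_summable.
  congr csum; apply/funext => n.
  by rewrite mulr0 subr0 invr1 expr1n expr0.
exists (fun n z => (z - 1) * G n z + n%:R * G n.-1 z).
  have -> : (fun z => (z - 1) ^+ j.+1 * h z) =
            (fun z => (z - 1) * ((z - 1) ^+ j * h z)).
    by apply/funext => z; rewrite exprS mulrA.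
  exact: disc_derivatives_mul.
move=> k; rewrite addSn /= G0 -addnS G0 addnS factS natrM sub0r mulN1r.
have -> : csum (fun n => b n * t n ^+ k * (1 - t n) ^+ j.+1) =
    csum (fun n => b n * t n ^+ k * (1 - t n) ^+ j) -
    csum (fun n => b n * t n ^+ k.+1 * (1 - t n) ^+ j).
  rewrite -mulN1r -csumZ; last exact: moment_summable.
  rewrite -csumD; last 2 first.
  - exact: moment_summable.
  - apply: (abs_summable_le (K := 1) (moment_summable j k.+1 bs t1)) => n.
    by rewrite mulN1r normc_opp mul1r.
  by congr csum; apply/funext => n; rewrite !exprS; ring.
by ring.
Qed.

(** With [P] the product and [S] the sum of the first [N] terms, the error
    [P - 1 - S] grows by [x N * (P - 1)] when a factor is added, and
    [|P - 1|] is at most twice the sum of the norms. *)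
Lemma prod_linear_approx (R : realType) (x : nat -> R[i]) N :
  \sum_(0 <= n < N) normc (x n) <= 1 ->
  normc (\prod_(0 <= n < N) (1 + x n) - 1 - \sum_(0 <= n < N) x n) <=
  (\sum_(0 <= n < N) normc (x n)) ^+ 2.
Proof.
elim: N => [|N IH].
  by rewrite !big_geq // subrr subr0 normc0 expr0n.
rewrite !big_nat_recr //=.
set P := \prod_(_ <= _ < _) _ in IH *.
set S := \sum_(0 <= n < N) x n in IH *.
set X := \sum_(0 <= n < N) normc (x n) in IH *.
move=> X1; have x0 := normc_ge0 (x N).
have X0 : 0 <= X by apply: sumr_ge0 => n _; exact: normc_ge0.
have {}IH := IH (ltac:(lra)).
have SX : normc S <= X by exact: normc_sum.
have P1 : normc (P - 1) <= 2 * X.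
  have := normc_triangle (P - 1 - S) S; rewrite subrK => H.
  have : X ^+ 2 <= X by rewrite expr2 ler_piMr //; lra.
  by lra.
have -> : P * (1 + x N) - 1 - (S + x N) = (P - 1 - S) + x N * (P - 1) by ring.
apply: le_trans (normc_triangle _ _) _; rewrite normcM.
have : normc (x N) * normc (P - 1) <= normc (x N) * (2 * X) by rewrite ler_wpM2l.
nra.
Qed.

(** Since [1 - (y + h) * b n] is [1 - y * b n] times
    [1 - h * b n / (1 - b n * y)], a small shift of [y] multiplies the product by
    one that is close to [1], to which [prod_linear_approx] applies.  No locally
    uniform convergence of the products is used. *)
Lemma is_derive_product (R : realType) (f : R[i] -> R[i]) (b : nat -> R[i])
    (rho : R) (y : R[i]) :
  abs_summable b ->
  (forall z, \prod_(0 <= n < N) (1 - z * b n) @[N --> \oo] --> f z) ->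
  (forall n, rho * normc (b n) <= 1) -> normc y < rho ->
  is_derive y 1 f (- (f y * csum (fun n => b n / (1 - b n * y)))).
Proof.
move=> bs fE b1 yr.
have r0 : 0 < rho by apply: le_lt_trans yr; exact: normc_ge0.
have y1 : normc (y / rho%:C) < 1.
  by rewrite normcM normcV normc_real gtr0_norm // ltr_pdivrMr // mul1r.
have t1 n : normc (rho%:C * b n) <= 1 by rewrite normcM normc_real gtr0_norm.
have r0c : rho%:C != 0 :> R[i] by rewrite -normc_gt0 normc_real normr_gt0 gt_eqF.
have tE n : rho%:C * b n * (y / rho%:C) = b n * y by field.
have nz n : 1 - b n * y != 0.
  by rewrite -tE; have [] := normc_resolvent_le (t1 n) y1.
pose c n := b n / (1 - b n * y).
have cs : abs_summable c.
  apply: (abs_summable_le (K := 1) (resolvent_summable 1 0 1 bs t1 y1)) => n.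
  by rewrite mul1r mul1r expr0 mulr1 expr1 tE.
have [S cS] := cs.
have S0 : 0 <= S by have := cS 0%N; rewrite big_geq.
apply: (@is_derive_quadratic _ _ _ _ ((normc (f y) + 1) * S ^+ 2) (S + 1)^-1).
  by rewrite invr_gt0; lra.
move=> h hS.
have PD : (\prod_(0 <= n < N) (1 - (y + h) * b n) - \prod_(0 <= n < N) (1 - y * b n)
   - h * - (\prod_(0 <= n < N) (1 - y * b n) * \sum_(0 <= n < N) c n))
  @[N --> \oo] --> f (y + h) - f y - h * - (f y * csum c).
  apply: cvgB; first by apply: cvgB; exact: fE.
  apply: cvgMr; apply: cvgN; apply: cvgM; first exact: fE.
  exact: csum_cvg.
apply: cvg_normc_le PD _.
have : \forall N \near \oo,
  normc (\prod_(0 <= n < N) (1 - y * b n)) <= normc (f y) + 1.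
  apply: (cvgr_le _ (cvg_normc (fE y))); lra.
apply: filterS => N; set P := \prod_(_ <= _ < _) (1 - y * b _) => PM.
(* The relative change of the n-th factor between y and y + h. *)
pose x n := - h * c n.
have -> : \prod_(0 <= n < N) (1 - (y + h) * b n) = P * \prod_(0 <= n < N) (1 + x n).
  rewrite -big_split /=; apply: eq_bigr => n _.
  by rewrite /x /c; field; exact: nz.
have xS : \sum_(0 <= n < N) normc (x n) <= normc h * S.
  rewrite /x; under eq_bigr do rewrite normcM normc_opp.
  by rewrite -mulr_sumr ler_wpM2l ?normc_ge0.
have hS1 : normc h * S <= 1.
  move: hS; rewrite -[X in _ < X]mul1r ltr_pdivlMr; last lra.
  by have := normc_ge0 h; nra.
have := prod_linear_approx (le_trans xS hS1).
set Q := \prod_(_ <= _ < _) (1 + x _) => H.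
have -> : P * Q - P - h * - (P * \sum_(0 <= n < N) c n) =
    P * (Q - 1 - \sum_(0 <= n < N) x n).
  by rewrite /x -mulr_sumr; ring.
rewrite normcM -mulrA; apply: ler_pM; rewrite ?normc_ge0 //.
apply: le_trans H _; rewrite -exprMn mulrC lerXn2r ?nnegrE //.
- by apply: sumr_ge0 => n _; exact: normc_ge0.
- by rewrite mulr_ge0 ?normc_ge0.
Qed.

(** * Polynomials nonnegative on the unit interval *)

(** The polynomials that are visibly nonnegative on the interval [0, 1]: those
    with nonnegative coefficients over the products of powers of ['X] and of
    [1 - 'X].  Generating them also by products makes closure under products, on
    which the whole argument rests, immediate. *)
Inductive bernstein_cone (R : realType) : {poly R[i]} -> Prop :=
| cone_const (c : R[i]) of 0 <= c : bernstein_cone c%:P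
| cone_X : bernstein_cone 'X
| cone_1X : bernstein_cone (1 - 'X)
| cone_add p q of bernstein_cone p & bernstein_cone q : bernstein_cone (p + q)
| cone_mul p q of bernstein_cone p & bernstein_cone q : bernstein_cone (p * q).

Lemma cone_exp (R : realType) (p : {poly R[i]}) N :
  bernstein_cone p -> bernstein_cone (p ^+ N).
Proof.
move=> hp; elim: N => [|N IH]; first by rewrite expr0; exact: cone_const.
by rewrite exprS; exact: cone_mul.
Qed.

Lemma cone_1exp (R : realType) (p : {poly R[i]}) N :
  bernstein_cone p -> bernstein_cone (1 - p) -> bernstein_cone (1 - p ^+ N).
Proof.
move=> hp h1p; elim: N => [|N IH].
  by rewrite expr0 subrr; exact: cone_const.
have -> : 1 - p ^+ N.+1 = (1 - p) + p * (1 - p ^+ N) by rewrite exprS; ring.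
by apply: cone_add => //; exact: cone_mul.
Qed.

Lemma cone_horner0 (R : realType) (p : {poly R[i]}) :
  bernstein_cone p -> 0 <= p.[0].
Proof.
elim=> [c c0|||q r _ q0 _ r0|q r _ q0 _ r0].
- by rewrite hornerC.
- by rewrite hornerX.
- by rewrite !hornerE subr0.
- by rewrite hornerD addr_ge0.
- by rewrite hornerM mulr_ge0.
Qed.

(** The mean of [(S - s) ^+ 2], where [S] is the number of successes in [n]
    independent trials of success probability ['X]. *)
Definition bernoulli_spread (R : realType) (n : nat) (s : R) : {poly R[i]} :=
  (n%:R * 'X - s%:C%:P) ^+ 2 + n%:R * ('X * (1 - 'X)).

(** Conditioning on the outcome of one trial. *)
Lemma bernoulli_spreadS (R : realType) n (s : R) :
  bernoulli_spread n.+1 s =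
  'X * bernoulli_spread n (s - 1) + (1 - 'X) * bernoulli_spread n s.
Proof.
by rewrite /bernoulli_spread rmorphB /= polyCB rmorph1 ?polyC1 -natr1; ring.
Qed.

Lemma cone_bernoulli_spread (R : realType) n (s : R) :
  bernstein_cone (bernoulli_spread n s).
Proof.
elim: n s => [|n IH] s.
  rewrite /bernoulli_spread !mul0r sub0r addr0 sqrrN -polyC_exp.
  apply: cone_const; rewrite -rmorphXn /= ler0c; exact: sqr_ge0.
rewrite bernoulli_spreadS.
by apply: cone_add; apply: cone_mul => //; [exact: cone_X|exact: cone_1X].
Qed.

(** All the values [(k - s) ^+ 2] with [k <= n] are at most [M ^+ 2]. *)
Lemma cone_sub_bernoulli_spread (R : realType) n (s M : R) :
  `|s| + n%:R <= M ->
  bernstein_cone ((M ^+ 2)%:C%:P - bernoulli_spread n s).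
Proof.
elim: n s => [|n IH] s.
  rewrite addr0 => sM; rewrite /bernoulli_spread !mul0r sub0r addr0 sqrrN.
  rewrite -polyC_exp -polyCB -rmorphXn -rmorphB /=; apply: cone_const.
  rewrite ler0c subr_ge0 -(ger0_norm (le_trans (normr_ge0 _) sM)).
  by rewrite -real_normK ?num_real // lerXn2r ?nnegrE // (le_trans sM) ?ler_norm.
move=> sM; rewrite bernoulli_spreadS.
have -> : (M ^+ 2)%:C%:P -
   ('X * bernoulli_spread n (s - 1) + (1 - 'X) * bernoulli_spread n s) =
   'X * ((M ^+ 2)%:C%:P - bernoulli_spread n (s - 1)) +
   (1 - 'X) * ((M ^+ 2)%:C%:P - bernoulli_spread n s) by ring.
move: sM; rewrite -natr1 => sM.
apply: cone_add; apply: cone_mul; [exact: cone_X| |exact: cone_1X|].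
  by apply: IH; have := ler_normB s 1; rewrite normr1; lra.
by apply: IH; lra.
Qed.

(** If [q] and [B - q] are in the cone, then [q] takes values between [0] and [B]
    on the interval [0, 1], so [w] is told apart from that interval.  For
    negative [w] take [q = 1 - 'X] and [B = 1].  For nonreal [w], the square
    [('X - Re w) ^+ 2] is nonnegative on [0, 1] and negative at [w], but it is
    not in the cone when it vanishes inside the interval.  The spread of [n]
    trials is [n ^+ 2] times it, up to an error linear in [n], and is in the
    cone; [q] is a large constant minus this spread. *)
Lemma cone_separation (R : realType) (w : R[i]) : normc w <= 1 -> ~~ (0 <= w) ->
  exists q : {poly R[i]}, exists B : R,
    [/\ bernstein_cone q, bernstein_cone (B%:C%:P - q), 0 <= B
      & B < normc q.[w]].
Proof.
move=> w1; rewrite lecE /= negb_and => w0.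
have [v0|v0] := eqVneq (complex.Im w) 0.
  move: w0; rewrite v0 eqxx /= -ltNge => u0.
  exists (1 - 'X), 1; split=> //; first exact: cone_1X.
    by rewrite (_ : _ - _ = 'X); [exact: cone_X | rewrite rmorph1 ?polyC1; ring].
  rewrite !hornerE.
  have -> : 1 - w = (1 - complex.Re w)%:C.
    by case: w v0 {w1 u0} => x y /= ->; apply/eqP; rewrite eq_complex /= subr0 !eqxx.
  by rewrite normc_real; apply: lt_le_trans (ler_norm _); lra.
have v20 : 0 < complex.Im w ^+ 2 by rewrite exprn_even_gt0.
pose n := (Num.truncn (2 / complex.Im w ^+ 2)).+1.
(* At w the gain n ^+ 2 * v ^+ 2, for v = Im w, must beat
   |n * w * (1 - w)| <= 2 * n. *)
have n2 : 2 < n%:R * complex.Im w ^+ 2.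
  by rewrite -ltr_pdivrMr // /n truncnS_gt.
have n0 : 0 < n%:R :> R by rewrite ltr0n.
(* M bounds |s| + n, as |Re w| <= 1. *)
pose M : R := 2 * n%:R.
pose s : R := n%:R * complex.Re w.
exists ((M ^+ 2)%:C%:P - bernoulli_spread n s), (M ^+ 2); split.
- apply: cone_sub_bernoulli_spread; rewrite /s /M normrM (ger0_norm (ltW n0)).
  have : n%:R * `|complex.Re w| <= n%:R.
    by rewrite ler_piMr ?(ltW n0) // (le_trans (Re_le_normc w) w1).
  lra.
- by rewrite subKr; exact: cone_bernoulli_spread.
- exact: sqr_ge0.
rewrite /bernoulli_spread -!polyC_natr expr2.
rewrite !(hornerD, hornerN, hornerM, hornerC, hornerX).
rewrite -expr2.
have -> : (M ^+ 2)%:C - ((n%:R * w - s%:C) ^+ 2 + n%:R * (w * (1 - w))) =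
  (M ^+ 2 + n%:R ^+ 2 * complex.Im w ^+ 2)%:C - n%:R * (w * (1 - w)).
  have wE : w = (complex.Re w)%:C + 'i * (complex.Im w)%:C by rewrite -complexE.
  have i2 : 'i ^+ 2 = - 1 :> R[i] by exact: sqr_i.
  rewrite opprD addrA; congr (_ - _).
  have -> : n%:R * w - s%:C = 'i * (n%:R * (complex.Im w)%:C).
    by rewrite {1}wE /s rmorphM rmorph_nat; ring.
  rewrite (exprMn 2 'i).
  rewrite i2.
  have -> : (M ^+ 2 + n%:R ^+ 2 * complex.Im w ^+ 2)%:C =
     (M ^+ 2)%:C + n%:R ^+ 2 * (complex.Im w)%:C ^+ 2.
    rewrite rmorphD; congr (_ + _); rewrite rmorphM !rmorphXn; congr (_ ^+ 2 * _).
    exact: rmorph_nat.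
  ring.
set a := M ^+ 2 + _; set z := n%:R * (w * _).
have a0 : 0 <= a by rewrite addr_ge0 ?sqr_ge0 // mulr_ge0 ?sqr_ge0.
have zn : normc z <= n%:R * 2.
  rewrite /z normcM normc_nat ler_wpM2l ?(ltW n0) // normcM.
  have := normc_triangle 1 (- w); rewrite normc_opp normc1 => h.
  by rewrite -[leRHS]mul1r; apply: ler_pM; rewrite ?normc_ge0 //; lra.
have := normc_triangle (a%:C - z) z; rewrite subrK normc_real ger0_norm //.
have : n%:R * 2 < n%:R ^+ 2 * complex.Im w ^+ 2.
  by rewrite expr2 -mulrA ltr_pM2l.
rewrite /a; lra.
Qed.

Lemma poly_bounded_disc (R : realType) (p : {poly R[i]}) :
  exists2 K : R, 0 <= K & forall x, normc x <= 1 -> normc p.[x] <= K.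
Proof.
exists (\sum_(i < size p) normc p`_i).
  by apply: sumr_ge0 => i _; exact: normc_ge0.
move=> x x1; rewrite horner_coef; apply: le_trans (normc_sum _ _) _.
apply: ler_sum => i _; rewrite normcM normcX ler_piMr ?normc_ge0 //.
by rewrite exprn_ile1 ?normc_ge0.
Qed.

(** Rescaling [q] by a constant strictly between [B] and [|q.[w]|] leaves room
    near [0], where [0 <= q.[0] <= B]. *)
Lemma cone_separation_near0 (R : realType) (w : R[i]) :
  normc w <= 1 -> ~~ (0 <= w) ->
  exists q : {poly R[i]}, exists r : R,
    [/\ bernstein_cone q, bernstein_cone (1 - q), 1 < normc q.[w], 0 < r
      & forall x, normc x <= r -> normc q.[x] <= 1].
Proof.
move=> w1 w0; have [q [B [hq hBq B0 qw]]] := cone_separation w1 w0.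
pose B' := (B + normc q.[w]) / 2.
have BB' : B < B' by rewrite /B'; lra.
have B'q : B' < normc q.[w] by rewrite /B'; lra.
have B'0 : 0 < B' by lra.
have nB' : normc B'%:C = B' by rewrite normc_real gtr0_norm.
have q0B : normc q.[0] <= B.
  have := cone_horner0 hq; have := cone_horner0 hBq.
  rewrite hornerD hornerN hornerC subr_ge0 => h1 h2.
  by rewrite -lecR -normcE_norm ger0_norm.
have [q1 q1E] : exists q1, q - q.[0]%:P = q1 * ('X - 0%:P).
  by apply/factor_theorem; rewrite rootE hornerD hornerN hornerC subrr.
have [K K0 HK] := poly_bounded_disc q1.
exists (B'^-1%:C *: q), (Num.min 1 ((B' - B) / (K + 1))).
have e0 : 0 < (B' - B) / (K + 1) by rewrite divr_gt0; lra.
split.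
- rewrite -mul_polyC; apply: cone_mul => //; apply: cone_const.
  by rewrite ler0c invr_ge0 ltW.
- have -> : 1 - B'^-1%:C *: q =
    B'^-1%:C%:P * ((B' - B)%:C%:P + (B%:C%:P - q)).
    have B'V : B'^-1%:C * B'%:C = 1 :> R[i].
      by rewrite -rmorphM mulVf ?rmorph1 // gt_eqF.
    rewrite rmorphB polyCB (addrA _ B%:C%:P) subrK mulrBr -polyCM B'V polyC1.
    by rewrite mul_polyC.
  apply: cone_mul; first by apply: cone_const; rewrite ler0c invr_ge0 ltW.
  by apply: cone_add => //; apply: cone_const; rewrite ler0c subr_ge0 ltW.
- rewrite hornerZ normcM normc_real ger0_norm ?invr_ge0 ?(ltW B'0) //.
  by rewrite mulrC ltr_pdivlMr // mul1r.
- by rewrite lt_min ltr01.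
move=> x; rewrite le_min => /andP[x1 xe].
rewrite hornerZ normcM normc_real ger0_norm ?invr_ge0 ?(ltW B'0) //.
rewrite mulrC ler_pdivrMr // mul1r.
have -> : q.[x] = q1.[x] * x + q.[0].
  have /(congr1 (horner^~ x)) := q1E.
  rewrite hornerD hornerN hornerC hornerM hornerXsubC subr0 => <-.
  by rewrite subrK.
apply: le_trans (normc_triangle _ _) _; rewrite normcM.
have : normc q1.[x] * normc x <= K * ((B' - B) / (K + 1)).
  by apply: ler_pM; rewrite ?normc_ge0 // HK.
have : K * ((B' - B) / (K + 1)) <= B' - B.
  rewrite mulrA ler_pdivrMr; last lra.
  nra.
lra.
Qed.

(** * Moments of a complex sequence of nodes *)

Lemma abs_summable_small (R : realType) (u : nat -> R[i]) (e : R) :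
  abs_summable u -> 0 < e -> exists N, forall n, (N <= n)%N -> normc (u n) <= e.
Proof.
move=> [S uS] e0.
have : cvgn (series (fun n => normc (u n))).
  apply: (@bounded_abs_series_cvg _ _ S) => N; under eq_bigr do
    rewrite (ger0_norm (normc_ge0 _)); exact: uS.
move=> /cvg_series_cvg_0 /cvgr0Pnorm_le /(_ e e0) [N _ HN].
by exists N => n /HN; rewrite /= ger0_norm ?normc_ge0.
Qed.

Lemma exp_unbounded (R : realType) (c D : R) : 1 < c -> exists N, D < c ^+ N.
Proof.
move=> c1.
have H N : 1 + N%:R * (c - 1) <= c ^+ N.
  elim: N => [|N IH]; first by rewrite mul0r addr0 expr0.
  have h1 : c * (1 + N%:R * (c - 1)) <= c * c ^+ N by rewrite ler_wpM2l //; lra.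
  have h2 : 0 <= N%:R * ((c - 1) * (c - 1)) by rewrite mulr_ge0 // -expr2 sqr_ge0.
  by rewrite exprS -natr1; lra.
exists (Num.truncn (`|D| / (c - 1))).+1; apply: lt_le_trans (H _).
have : `|D| / (c - 1) < (Num.truncn (`|D| / (c - 1))).+1%:R by rewrite truncnS_gt.
rewrite ltr_pdivrMr; last lra.
have := ler_norm D; lra.
Qed.

Definition moment (R : realType) (b t : nat -> R[i]) (p : {poly R[i]}) : R[i] :=
  csum (fun n => b n * p.[t n]).

Lemma poly_moment_summable (R : realType) (b t : nat -> R[i]) p :
  abs_summable b -> (forall n, normc (t n) <= 1) ->
  abs_summable (fun n => b n * p.[t n]).
Proof.
move=> bs t1; have [K K0 HK] := poly_bounded_disc p.
apply: (abs_summable_le (K := K) bs) => n.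
by rewrite normcM mulrC ler_wpM2r ?normc_ge0 // HK.
Qed.

Lemma momentD (R : realType) (b t : nat -> R[i]) p q :
  abs_summable b -> (forall n, normc (t n) <= 1) ->
  moment b t (p + q) = moment b t p + moment b t q.
Proof.
move=> bs t1; rewrite /moment -csumD; try exact: poly_moment_summable.
by congr csum; apply/funext => n; rewrite hornerD mulrDr.
Qed.

Lemma momentZ (R : realType) (b t : nat -> R[i]) c p :
  abs_summable b -> (forall n, normc (t n) <= 1) ->
  moment b t (c *: p) = c * moment b t p.
Proof.
move=> bs t1; rewrite /moment -csumZ; last exact: poly_moment_summable.
by congr csum; apply/funext => n; rewrite hornerZ mulrCA.
Qed.

(** Induction over the cone needs the factor [r], because nonnegativity of
    [moment b t] on two polynomials says nothing about their product. *)
Lemma moment_cone_mul (R : realType) (b t : nat -> R[i]) (p : {poly R[i]}) :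
  abs_summable b -> (forall n, normc (t n) <= 1) -> bernstein_cone p ->
  forall r, (forall j k, 0 <= moment b t (r * ('X ^+ k * (1 - 'X) ^+ j))) ->
  forall j k, 0 <= moment b t (r * p * ('X ^+ k * (1 - 'X) ^+ j)).
Proof.
move=> bs t1.
elim=> [c c0|||q s _ IHq _ IHs|q s _ IHq _ IHs] r r0 j k.
- have -> : r * c%:P * ('X ^+ k * (1 - 'X) ^+ j) =
     c *: (r * ('X ^+ k * (1 - 'X) ^+ j)) by rewrite -mul_polyC; ring.
  by rewrite momentZ // mulr_ge0.
- by have := r0 j k.+1; rewrite exprS !mulrA.
- have -> : r * (1 - 'X) * ('X ^+ k * (1 - 'X) ^+ j) =
     r * ('X ^+ k * (1 - 'X) ^+ j.+1) by rewrite [in RHS]exprS; ring.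
  exact: r0.
- rewrite mulrDr mulrDl (momentD _ _ bs t1).
  by apply: addr_ge0; [exact: IHq|exact: IHs].
- by rewrite (mulrA r); apply: IHs => j' k'; apply: IHq.
Qed.

(** On monomials, [q ^+ N * 'X^i] and [(1 - q ^+ N) * 'X^i] are both in the
    cone, so the moment of the former is between [0] and that of ['X^i]. *)
Lemma moment_exp_bounded (R : realType) (b t : nat -> R[i])
    (q p : {poly R[i]}) :
  abs_summable b -> (forall n, normc (t n) <= 1) ->
  (forall r, bernstein_cone r -> 0 <= moment b t r) ->
  bernstein_cone q -> bernstein_cone (1 - q) ->
  exists K : R, forall N, normc (moment b t (q ^+ N * p)) <= K.
Proof.
move=> bs t1 L0 hq h1q.
rewrite -(coefK p) poly_def; apply: (big_ind (fun p : {poly R[i]} =>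
  exists K : R, forall N, normc (moment b t (q ^+ N * p)) <= K)).
- by exists (normc (moment b t 0)) => N; rewrite mulr0.
- move=> p1 p2 [K1 H1] [K2 H2]; exists (K1 + K2) => N.
  rewrite mulrDr momentD //; apply: le_trans (normc_triangle _ _) _.
  exact: lerD.
move=> i _; exists (normc p`_i * normc (moment b t 'X^i)) => N.
rewrite -scalerAr momentZ // normcM ler_wpM2l ?normc_ge0 //.
have hX : bernstein_cone ('X^i : {poly R[i]}) by apply: cone_exp; exact: cone_X.
have m0 : 0 <= moment b t (q ^+ N * 'X^i).
  by apply: L0; apply: cone_mul => //; exact: cone_exp.
have m1 : 0 <= moment b t ((1 - q ^+ N) * 'X^i).
  by apply: L0; apply: cone_mul => //; exact: cone_1exp.
rewrite -lecR -!normcE_norm ger0_norm //.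
have E : moment b t 'X^i =
    moment b t ((1 - q ^+ N) * 'X^i) + moment b t (q ^+ N * 'X^i).
  by rewrite -momentD // mulrBl mul1r subrK.
by rewrite E ger0_norm ?addr_ge0 // lerDr.
Qed.

(** For a node [w] outside [0, 1], the moments of [q ^+ N * p0] are bounded in
    [N] by the cone argument, and they are also a nonzero multiple of
    [q.[w] ^+ N] up to a bounded error. *)
Lemma moment_nodes_ge0 (R : realType) (b : nat -> R[i]) (rho : R) :
  abs_summable b -> 0 < rho -> (forall n, rho * normc (b n) <= 1) ->
  (forall j k,
    0 <= csum (fun n => b n * (rho%:C * b n) ^+ k * (1 - rho%:C * b n) ^+ j)) ->
  forall n, 0 <= rho%:C * b n.
Proof.
move=> bs r0 b1 M0 n0; apply/negPn/negP.
pose t n := rho%:C * b n.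
have nt n : normc (t n) = rho * normc (b n) by rewrite normcM normc_real gtr0_norm.
have t1 n : normc (t n) <= 1 by rewrite nt.
have r0c : rho%:C != 0 :> R[i] by rewrite -normc_gt0 normc_real normr_gt0 gt_eqF.
rewrite -/(t n0); set w := t n0 => w0.
have L0 p : bernstein_cone p -> 0 <= moment b t p.
  move=> hp; have := @moment_cone_mul _ b t p bs t1 hp 1 _ 0 0.
  rewrite !expr0 !mulr1 mul1r; apply => j k; rewrite mul1r.
  have := M0 j k; rewrite /moment; congr (0 <= csum _); apply/funext => n.
  by rewrite hornerM !horner_exp hornerD hornerN hornerX -polyC1 hornerC mulrA.
have [q [r [hq h1q qw rr qr]]] := cone_separation_near0 (t1 n0) w0.
have [n1 Hn1] := abs_summable_small bs (divr_gt0 rr r0).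
have tr n : (n1 <= n)%N -> normc (t n) <= r.
  by move=> /Hn1; rewrite nt ler_pdivlMr // mulrC.
(* |q| <= 1 at the nodes of index at least n1, whereas |q.[w]| > 1. *)
have n01 : (n0 < n1)%N.
  by rewrite ltnNge; apply/negP => /tr /qr; rewrite leNgt qw.
pose p0 : {poly R[i]} := \prod_(0 <= n < n1 | t n != w) ('X - (t n)%:P).
have p0w : p0.[w] != 0.
  rewrite /p0 horner_prod prodf_seq_neq0; apply/allP => n _; apply/implyP => h.
  by rewrite hornerXsubC subr_eq0 eq_sym.
have p0t n : (n < n1)%N -> t n != w -> p0.[t n] = 0.
  move=> nn1 h; apply/eqP; rewrite /p0 horner_prod prodf_seq_eq0.
  apply/hasP; exists n; first by rewrite mem_index_iota.
  by rewrite h hornerXsubC subrr eqxx.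
have [K0 K00 HK0] := poly_bounded_disc p0.
have [S bS] := bs.
have [K HK] := moment_exp_bounded p0 bs t1 L0 hq h1q.
(* Total weight of the nodes equal to w: each has b n = w / rho, so nothing
   cancels. *)
pose A := \sum_(0 <= n < n1 | t n == w) b n.
have A0 : A != 0.
  have w00 : w != 0 by apply: contraNneq w0 => ->.
  have : 0 < A / w * rho%:C.
    rewrite /A !mulr_suml big_mkcond /=.
    rewrite (bigD1_seq n0) ?mem_index_iota ?iota_uniq //= eqxx.
    apply: ltr_wpDr.
      apply: sumr_ge0 => n _; case: eqP => // tw.
      by rewrite mulrAC (mulrC (b n)) -/(t n) tw mulfV.
    by rewrite mulrAC (mulrC (b n0)) -/(t n0) mulfV.
  by apply: contraTneq => ->; rewrite !mul0r ltxx.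
have main N : normc A * normc p0.[w] * normc q.[w] ^+ N <= K + S * K0.
  (* Up to index n1 only the nodes equal to w survive; after n1, |q| <= 1. *)
  have tail : normc (moment b t (q ^+ N * p0) - A * (q ^+ N * p0).[w]) <= S * K0.
    have cv := csum_cvg (poly_moment_summable (q ^+ N * p0) bs t1).
    have cv2 : (\sum_(0 <= n < M) b n * (q ^+ N * p0).[t n] - A * (q ^+ N * p0).[w])
        @[M --> \oo] --> moment b t (q ^+ N * p0) - A * (q ^+ N * p0).[w].
      exact: (cvgB cv (cvg_cst _)).
    apply: cvg_normc_le cv2 _; exists n1 => // M /= n1M.
    rewrite (big_cat_nat (leq0n n1) n1M) //=.
    have -> : \sum_(0 <= n < n1) b n * (q ^+ N * p0).[t n] = A * (q ^+ N * p0).[w].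
      rewrite /A mulr_suml [RHS]big_mkcond /=; apply: eq_big_nat => n /andP[_ nn1].
      case: eqVneq => [->//|h].
      by rewrite hornerM p0t // !mulr0.
    rewrite addrAC subrr add0r; apply: le_trans (normc_sum _ _) _.
    apply: (@le_trans _ _ (\sum_(n1 <= n < M) normc (b n) * K0)).
      rewrite big_nat_cond [leRHS]big_nat_cond; apply: ler_sum => n.
      rewrite andbT => /andP[n1n _]; rewrite normcM ler_wpM2l ?normc_ge0 //.
      rewrite hornerM horner_exp normcM normcX.
      apply: (@le_trans _ _ (1 * normc p0.[t n])); last by rewrite mul1r HK0.
      by rewrite ler_wpM2r ?normc_ge0 // exprn_ile1 ?normc_ge0 ?qr ?tr.
    rewrite -mulr_suml ler_wpM2r //; apply: le_trans (bS M).
    rewrite (big_cat_nat (leq0n n1) n1M) //= lerDr.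
    by apply: sumr_ge0 => n _; exact: normc_ge0.
  have -> : normc A * normc p0.[w] * normc q.[w] ^+ N =
      normc (A * (q ^+ N * p0).[w]).
    by rewrite hornerM horner_exp !normcM normcX; ring.
  have := normc_triangle (moment b t (q ^+ N * p0))
    (- (moment b t (q ^+ N * p0) - A * (q ^+ N * p0).[w])).
  rewrite normc_opp opprB addrC subrK; have := HK N; lra.
have Ap : 0 < normc A * normc p0.[w] by rewrite mulr_gt0 ?normc_gt0.
have [N] := exp_unbounded ((K + S * K0) / (normc A * normc p0.[w])) qw.
by rewrite ltr_pdivrMr // ltNge mulrC main.
Qed.

(** * The logarithmic derivative in genus zero *)

Lemma cexp0 (R : realType) : cexp 0 = 1 :> R[i].
Proof. by rewrite /cexp /= expR0 cos0 sin0 mulr0 mulr1. Qed.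

(** Setting [b n = 0] at the indices that carry no root turns the product over
    the roots into one over all of [nat], because the new factors are [1].
    Evaluation at [0] removes [z ^+ m] and the exponential. *)
Lemma genus0_product (R : realType) (f : R[i] -> R[i]) :
  has_genus f 0 -> f 0 = 1 ->
  exists b : nat -> R[i],
    [/\ abs_summable b,
        forall z, \prod_(0 <= n < N) (1 - z * b n) @[N --> \oo] --> f z
      & forall z, f z = 0 -> exists n, z * b n = 1].
Proof.
move=> [_ _ [m [p [D [a [k [[a0 aE] ks _ fE mk]]]]]]] f0.
have k0 : k = 0%N by apply/eqP; rewrite -leqn0 mk leq_maxr.
have p1 : (size p <= 1)%N by rewrite -subn_eq0 subn1 -leqn0 mk leq_maxl.
have [c pc] : exists c, p = c%:P by exists p`_0; exact: size1_polyC.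
subst k p.
pose b n := if D n then (a n)^-1 else 0.
have prodE z N :
    \prod_(0 <= n < N | D n) primary_factor 0 (z / a n) =
    \prod_(0 <= n < N) (1 - z * b n).
  rewrite big_mkcond; apply: eq_bigr => n _; rewrite /b.
  case: (D n); last by rewrite mulr0 subr0.
  by rewrite /primary_factor big_geq // cexp0 mulr1.
have c1 : 0 ^+ m * cexp c = 1.
  have prod1 N : \prod_(0 <= n < N) (1 - 0 * b n) = 1.
    by apply: big1 => n _; rewrite mul0r subr0.
  have := fE 0; under eq_cvg do rewrite hornerC prodE prod1 mulr1.
  by rewrite f0 => /cvg_lim <- //; exact/esym/lim_cst.
have m0 : m = 0%N.
  by case: m c1 {fE} => // m; rewrite exprS !mul0r => /eqP; rewrite eq_sym oner_eq0.
subst m; rewrite expr0 mul1r in c1.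
exists b; split.
- move: ks; rewrite /summable_inverse_powers.
  set L := limn _ => Lfin.
  have H N : ((\sum_(0 <= n < N) normc (b n))%:E <= L)%E.
    rewrite -sumEFin.
    have -> : (\sum_(0 <= n < N) (normc (b n))%:E =
       \sum_(0 <= n < N | D n) (normc (a n) ^- 1)%:E)%E.
      rewrite [RHS]big_mkcond; apply: eq_bigr => n _; rewrite /b.
      by case: (D n); rewrite ?normcV ?expr1 ?normc0.
    apply: nneseries_lim_ge => n _ _.
    by rewrite lee_fin invr_ge0 expr1 normc_ge0.
  exists (fine L) => N; rewrite -lee_fin fineK //.
  rewrite ge0_fin_numE //; apply: le_trans (H 0%N).
  by rewrite big_geq.
- move=> z; have := fE z.
  by under eq_cvg do rewrite hornerC expr0 mul1r c1 mul1r prodE.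
- move=> z fz.
  have z0 : z != 0 by apply: contra_eqN fz => /eqP ->; rewrite f0 oner_neq0.
  have [d [[g [_ gz fg]] card]] := aE z z0.
  have d0 : d != 0%N.
    by apply: contraNneq gz => d0; rewrite -fz fg d0 expr0 mul1r.
  have [n [Dn an]] : [set n | D n /\ a n = z] !=set0.
    apply/set0P; apply: contraNneq d0 => E.
    move: card; rewrite E card_eq_sym card_eq0 => /eqP I0.
    case: d I0 {fg} => // d I0.
    by have : `I_d.+1 0%N by []; rewrite I0.
  by exists n; rewrite /b Dn an mulfV.
Qed.

Lemma product_root (R : realType) (f : R[i] -> R[i]) (b : nat -> R[i]) n :
  (forall z, \prod_(0 <= n < N) (1 - z * b n) @[N --> \oo] --> f z) ->
  b n != 0 -> f (b n)^-1 = 0.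
Proof.
move=> fE bn0; apply: eq0_normc; apply/eqP; rewrite eq_le normc_ge0 andbT.
apply: cvg_normc_le (fE _) _; exists n.+1 => // N /= nN.
rewrite (bigD1_seq n) ?mem_index_iota ?iota_uniq //=.
by rewrite mulVf // subrr mul0r normc0.
Qed.

(** Because [rho * |b n| <= 1], there is no root in the open disc of radius
    [rho], and the logarithmic derivative is the sum of those of the factors. *)
Lemma log_derivative_moments (R : realType) (f : R[i] -> R[i])
    (b : nat -> R[i]) (rho : R) j k :
  abs_summable b ->
  (forall z, \prod_(0 <= n < N) (1 - z * b n) @[N --> \oo] --> f z) ->
  (forall z, f z = 0 -> exists n, z * b n = 1) ->
  0 < rho -> (forall n, rho * normc (b n) <= 1) ->
  (fun z : R[i] =>
    (z - 1) ^+ j * (f^`()%classic (rho%:C * z) / f (rho%:C * z)))^`(j + k)%classic 0 =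
  - ((j + k)`!%:R *
     csum (fun n => b n * (rho%:C * b n) ^+ k * (1 - rho%:C * b n) ^+ j)).
Proof.
move=> bs fE froot r0 b1.
have t1 n : normc (rho%:C * b n) <= 1 by rewrite normcM normc_real gtr0_norm.
have bNs : abs_summable (fun n => - b n).
  by apply: (abs_summable_le (K := 1) bs) => n; rewrite normc_opp mul1r.
have hE (z : R[i]) : normc z < 1 -> f^`()%classic (rho%:C * z) / f (rho%:C * z) =
    csum (fun n => - b n / (1 - rho%:C * b n * z)).
  move=> z1.
  have rz : normc (rho%:C * z) < rho.
    by rewrite normcM normc_real gtr0_norm // gtr_pMr.
  have fn0 : f (rho%:C * z) != 0.
    apply/eqP => /froot[n /(congr1 (@normc R))]; rewrite normc1 normcM => E.
    have := b1 n; rewrite -E leNgt => /negP; apply.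
    rewrite ltr_pM2r // lt_neqAle normc_ge0 andbT; apply/eqP => bn0.
    by move: E; rewrite -bn0 mulr0 => /eqP; rewrite eq_sym oner_eq0.
  rewrite derive1E; have [_ ->] := is_derive_product bs fE b1 rz.
  have tz n : b n * (rho%:C * z) = rho%:C * b n * z by rewrite mulrCA mulrA.
  have s : abs_summable (fun n => b n / (1 - b n * (rho%:C * z))).
    apply: (abs_summable_le (K := 1) (resolvent_summable 1 0 1 bs t1 z1)) => n.
    by rewrite !mul1r expr0 mulr1 expr1 tz.
  rewrite mulNr mulrAC mulfV // mul1r -mulN1r -csumZ //; congr csum.
  by apply/funext => n; rewrite mulN1r mulNr tz.
rewrite (moment_derivative j k bNs t1 hE) -mulrN; congr (_ * _).
rewrite -(mulN1r (csum _)) -csumZ; last exact: moment_summable.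
by congr csum; apply/funext => n; rewrite mulN1r !mulNr.
Qed.

Theorem theorem5 (R : realType) (f : R[i] -> R[i])
  (f_genus0 : has_genus f 0) (f0 : f 0 = 1) :
  (forall z : R[i], f z = 0 -> 0 < z) <->
  (exists rho : R,
     [/\ 0 < rho,
         (rho%:E <= ereal_inf [set (normc z)%:E | z in [set z | f z = 0%R]])%E &
         forall j k : nat,
           (fun z : R[i] =>
              (z - 1) ^+ j * (f^`()%classic (rho%:C * z) / f (rho%:C * z)))^`(j + k)%classic 0
           <= 0]).
Proof.
have [b [bs fE froot]] := genus0_product f_genus0 f0.
have normb z n : z * b n = 1 -> normc z * normc (b n) = 1.
  by move=> E; rewrite -normcM E normc1.
split=> [fpos|[rho [rho0 rho_inf H]]].
  have b0 n : 0 <= b n.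
    have [->//|bn0] := eqVneq (b n) 0.
    by rewrite -invr_ge0; apply/ltW/fpos; exact: product_root fE bn0.
  have [S bS] := bs.
  have bnS n : normc (b n) <= S.
    apply: le_trans (bS n.+1); rewrite big_nat_recr //= lerDr.
    by apply: sumr_ge0 => i _; exact: normc_ge0.
  have S0 : 0 <= S := le_trans (normc_ge0 _) (bnS 0%N).
  have S1 : 0 < S + 1 by rewrite ltr_wpDl.
  have b1 n : (S + 1)^-1 * normc (b n) <= 1.
    by rewrite mulrC ler_pdivrMr // mul1r; have := bnS n; lra.
  (* S bounds every |b n|, so the inverse of S + 1 is at most the norm of every
     root; the 1 covers S = 0, when f has no roots. *)
  exists (S + 1)^-1; split.
  - by rewrite invr_gt0.
  - apply: le_ereal_inf_tmp => _ [z /= /froot[n /normb E] <-]; rewrite lee_fin.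
    have -> : (S + 1)^-1 = (S + 1)^-1 * normc (b n) * normc z.
      by rewrite -mulrA (mulrC (normc (b n))) E mulr1.
    by rewrite ler_piMl ?normc_ge0.
  - move=> j k; rewrite (log_derivative_moments _ _ bs fE froot) ?invr_gt0 //.
    rewrite oppr_le0 mulr_ge0 //; apply: csum_ge0.
      apply: moment_summable => // n.
      by rewrite normcM normc_real gtr0_norm ?invr_gt0.
    move=> n; have t0 : 0 <= (S + 1)^-1%:C * b n.
      by rewrite mulr_ge0 // ler0c invr_ge0 ltW.
    rewrite !mulr_ge0 ?exprn_ge0 // subr_ge0.
    rewrite -(ger0_norm t0) normcE_norm normcM normc_real gtr0_norm ?invr_gt0 //.
    by rewrite (_ : 1 = 1%:C) // lecR.
have b1 n : rho * normc (b n) <= 1.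
  have [->|bn0] := eqVneq (b n) 0; first by rewrite normc0 mulr0.
  rewrite -ler_pdivlMr ?normc_gt0 // mul1r -normcV -lee_fin.
  apply: le_trans rho_inf _; apply: ereal_inf_lbound.
  by exists (b n)^-1 => //=; exact: product_root fE bn0.
have t0 : forall n, 0 <= rho%:C * b n.
  apply: moment_nodes_ge0 => // j k.
  have := H j k; rewrite (log_derivative_moments _ _ bs fE froot) // oppr_le0.
  by rewrite pmulr_rge0 // ltr0n fact_gt0.
move=> z /froot[n zb].
have bn0 : b n != 0.
  by apply: contra_eqN zb => /eqP ->; rewrite mulr0 eq_sym oner_eq0.
have rho0c : 0 < rho%:C :> R[i] by rewrite ltcR.
have -> : z = (b n)^-1 by rewrite -[RHS]mul1r -zb mulfK.
by rewrite invr_gt0 lt_neqAle eq_sym bn0 -(pmulr_rge0 _ rho0c) t0.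
Qed.
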